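(* Let $r\ge 1$ be an integer. If $B=[b_1,b_2,\ldots,b_n]$ is the imbalance sequence (listed in non-decreasing order, $b_1\le b_2\le\cdots\le b_n$) of an $r$-graph $D$, then for each $i$ with $1\le i\le n$, $$r(i-n)\le b_i\le r(i-1).$$
   Context: For an integer $r\ge 1$, an $r$-graph (short for $r$-digraph) is a finite directed multigraph without loops in which any two distinct vertices are joined by at most $r$ arcs in total (counting arcs in both directions). The imbalance of a vertex $v$ is $b_v=d_v^{+}-d_v^{-}$, where $d_v^{+}$ and $d_v^{-}$ are the outdegree and indegree of $v$ (counted with multiplicity). The imbalance sequence of an $r$-graph is the list of the imbalances of its vertices (one entry per vertex) in non-decreasing order. *)

(* Defs.v *)
From HB Require Import structures.
From mathcomp Require Import all_boot all_order all_algebra.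
Set Implicit Arguments.
Unset Strict Implicit.
Unset Printing Implicit Defensive.
Import Order.TTheory GRing.Theory Num.Theory.
Local Open Scope ring_scope.

(* A finite directed multigraph on the vertex type V is given by its arc
   multiplicities: [arcs D u v] is the number of arcs from u to v. *)
Record rdigraph (r : nat) (V : finType) := RDigraph {
  arcs : V -> V -> nat;
  arcs_loopless : forall v : V, arcs v v = 0%N;
  arcs_bound : forall u v : V, u != v -> (arcs u v + arcs v u <= r)%N
}.

Definition outdeg (r : nat) (V : finType) (D : rdigraph r V) (v : V) : nat :=
  (\sum_(w : V) arcs D v w)%N.

Definition indeg (r : nat) (V : finType) (D : rdigraph r V) (v : V) : nat :=
  (\sum_(w : V) arcs D w v)%N.

Definition imbalance (r : nat) (V : finType) (D : rdigraph r V) (v : V) : int :=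
  (outdeg D v)%:Z - (indeg D v)%:Z.

Definition imbalance_seq (r : nat) (V : finType) (D : rdigraph r V) : seq int :=
  sort <=%R [seq imbalance D v | v <- enum V].

(* Main.v *)
(** Arcs inside a vertex set [S] do not contribute to the sum of the imbalances
    over [S], so that sum is at most [r * #|S| * #|~: S|] in absolute value.
    Take for [S] the vertices of imbalance at least (resp. at most) [b_i]:
    it has at least [n - i + 1] (resp. [i]) elements, and comparing the sum with
    [#|S| * b_i] and dividing by [#|S|] gives the upper (resp. lower) bound. *)
Require Import Defs.
From HB Require Import structures.
From mathcomp Require Import all_boot all_order all_algebra.
Set Implicit Arguments.
Unset Strict Implicit.
Unset Printing Implicit Defensive.
Import Order.TTheory GRing.Theory Num.Theory.
Local Open Scope ring_scope.

Lemma imbalanceE (r : nat) (V : finType) (D : rdigraph r V) (v : V) :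
  imbalance D v = \sum_w ((arcs D v w)%:Z - (arcs D w v)%:Z).
Proof. by rewrite /imbalance /outdeg /indeg !(big_morph Posz PoszD erefl) sumrB. Qed.

Lemma sum_imbalance_cut (r : nat) (V : finType) (D : rdigraph r V) (S : {set V}) :
  \sum_(v in S) imbalance D v =
  \sum_(v in S) \sum_(w in ~: S) ((arcs D v w)%:Z - (arcs D w v)%:Z).
Proof.
have inner0 : \sum_(v in S) \sum_(w in S) ((arcs D v w)%:Z - (arcs D w v)%:Z) = 0.
  (* Exchanging the roles of [v] and [w] turns the double sum of out-arcs into that of in-arcs. *)
  under eq_bigr do rewrite sumrB.
  by rewrite sumrB [X in _ - X]exchange_big subrr.
rewrite -[RHS]add0r -[X in _ = X + _]inner0 -big_split; apply: eq_bigr => v _ /=.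
rewrite imbalanceE (bigID (mem S)) /=; congr (_ + _).
by apply: eq_bigl => w; rewrite inE.
Qed.

(** Each pair across the cut contributes at most [r] in absolute value, its arcs in both directions
    totalling at most [r]. *)
Lemma norm_sum_imbalance_le (r : nat) (V : finType) (D : rdigraph r V) (S : {set V}) :
  `|\sum_(v in S) imbalance D v| <= (r * #|~: S|)%:Z *+ #|S|.
Proof.
rewrite sum_imbalance_cut -sumr_const; apply: le_trans (ler_norm_sum _ _ _) _.
apply: ler_sum => v vS; apply: le_trans (ler_norm_sum _ _ _) _.
rewrite PoszM -[#|~: S|%:Z]natz mulr_natr -sumr_const.
apply: ler_sum => w; rewrite inE => wS.
have vw : v != w by apply: contraNneq wS => <-.
apply: le_trans (ler_normB _ _) _.
by rewrite !ger0_norm // -PoszD lez_nat arcs_bound.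
Qed.

(** Turns positions in the sorted list into sizes of vertex sets: sorting preserves counts and
    [enum V] lists each vertex once. *)
Lemma count_imbalance_seq (r : nat) (V : finType) (D : rdigraph r V) (p : pred int) :
  count p (imbalance_seq D) = #|[set v | p (imbalance D v)]|.
Proof.
rewrite /imbalance_seq count_sort count_map cardE -size_filter enumT [in RHS]/enum_mem.
by apply/congr1/eq_filter => v; rewrite /= inE.
Qed.

(** All entries of [drop j s] qualify. *)
Lemma count_ge_nth_sorted (s : seq int) (j : nat) :
  sorted <=%R s -> (size s - j <= count (fun y => nth 0%R s j <= y)%R s)%N.
Proof.
move=> ss; rewrite -{3}(cat_take_drop j s) count_cat -size_drop.
suff : all (fun y => nth 0 s j <= y) (drop j s).
  by rewrite all_count => /eqP ->; rewrite leq_addl.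
apply/(all_nthP 0) => k; rewrite size_drop nth_drop ltn_subRL => lt_jk.
apply: (sorted_leq_nth le_trans lexx) => //; rewrite ?inE ?leq_addr //.
exact: leq_ltn_trans (leq_addr k j) lt_jk.
Qed.

(** All entries of [take j.+1 s] qualify, and [j < size s] makes this prefix have full length. *)
Lemma count_le_nth_sorted (s : seq int) (j : nat) :
  sorted <=%R s -> (j < size s)%N -> (j < count (fun y => y <= nth 0%R s j)%R s)%N.
Proof.
move=> ss ltjs; rewrite -{2}(cat_take_drop j.+1 s) count_cat.
suff : all (fun y => y <= nth 0 s j) (take j.+1 s).
  by rewrite all_count => /eqP ->; rewrite size_takel // leq_addr.
apply/(all_nthP 0) => k; rewrite size_takel // => lt_kj; rewrite nth_take //.
by apply: (sorted_leq_nth le_trans lexx) => //; rewrite inE (leq_trans lt_kj).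
Qed.

Theorem theorem7 (r : nat) (hr : (1 <= r)%N) (V : finType) (D : rdigraph r V)
    (n : nat) (B : seq int) (hB : B = imbalance_seq D) (hn : size B = n)
    (i : nat) (hi : (1 <= i <= n)%N) :
  r%:Z * (i%:Z - n%:Z) <= nth 0 B (i - 1)%N /\
  nth 0 B (i - 1)%N <= r%:Z * (i%:Z - 1).
Proof.
have sB : sorted <=%R B by rewrite hB; apply: sort_le_sorted.
have nV : #|V| = n by rewrite -hn hB size_sort size_map cardE.
(* With [i = j.+1], the zero-based index of the entry is [j]. *)
case: i hi => // j /= ltjn; rewrite subn1 /=; set x := nth 0 B j.
split.
- have := count_le_nth_sorted sB; rewrite hn => /(_ _ ltjn).
  rewrite -/x hB count_imbalance_seq; set S := finset _ => ltjS.
  have S0 : (0 < #|S|)%N by apply: leq_trans ltjS.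
  have : - ((r * #|~: S|)%:Z) <= x.
    rewrite -(ler_pMn2r S0) mulNrn.
    have := norm_sum_imbalance_le D S; rewrite ler_norml => /andP[lo _].
    apply: le_trans lo _; rewrite -sumr_const.
    by apply: ler_sum => v; rewrite inE.
  (* It remains to see that [#|~: S| <= n - j.+1], which follows from [j < #|S|]. *)
  apply: le_trans; rewrite -opprB mulrN lerN2 subzn // -PoszM lez_nat.
  by rewrite leq_mul2l leq_subRL // -nV -(cardsC S) leq_add2r ltjS orbT.
- have := count_ge_nth_sorted j sB; rewrite hn -/x hB count_imbalance_seq.
  set S := finset _ => leS.
  have S0 : (0 < #|S|)%N by apply: leq_trans leS; rewrite subn_gt0.
  have : x <= (r * #|~: S|)%:Z.
    rewrite -(ler_pMn2r S0).
    have := norm_sum_imbalance_le D S; rewrite ler_norml => /andP[_].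
    apply: le_trans; rewrite -sumr_const.
    by apply: ler_sum => v; rewrite inE.
  (* Here [#|~: S| <= j] is needed; it follows from [n - j <= #|S|]. *)
  move=> lex; apply: le_trans lex _; rewrite subzn // subn1 /= -PoszM lez_nat.
  move: leS; rewrite leq_subLR -nV -(cardsC S) addnC leq_add2r => leS.
  by rewrite leq_mul2l leS orbT.
Qed.
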